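(* Let $\Omega\subset\mathbb{R}^2$ be open, let $\gamma\in\mathbb{R}$ be a constant, and let $Q_0=(\rho_0,u_0,v_0,p_0)^t$ be a smooth ($C^\infty$) vector-valued function of $(x,y)\in\Omega$, independent of $t$, with $\rho_0(x,y)>0$ for all $(x,y)\in\Omega$. Let $Q_n=(\rho_n,u_n,v_n,p_n)^t$ and $N_n=(A_n,B_n,C_n,D_n)^t$, $n\ge 0$, be the functions of $(x,y,t)$ defined recursively from $Q_0$ by the Adomian decomposition for the two-dimensional Euler equations in primitive variables, namely, for every $n\ge 0$, $$\begin{aligned} A_n&=-\sum_{j=0}^{n}\bigl(\partial_x(\rho_{n-j}u_j)+\partial_y(\rho_{n-j}v_j)\bigr),\\ B_n&=-\sum_{j=0}^{n}\bigl(u_{n-j}\,\partial_x u_j+v_{n-j}\,\partial_y u_j+\widehat{\rho}_{n-j}\,\partial_x p_j\bigr),\\ C_n&=-\sum_{j=0}^{n}\bigl(u_{n-j}\,\partial_x v_j+v_{n-j}\,\partial_y v_j+\widehat{\rho}_{n-j}\,\partial_y p_j\bigr),\\ D_n&=-\sum_{j=0}^{n}\bigl(u_{n-j}\,\partial_x p_j+v_{n-j}\,\partial_y p_j+\gamma\,p_j(\partial_x u_{n-j}+\partial_y v_{n-j})\bigr), \end{aligned}$$ $$Q_{n+1}(x,y,t)=\int_0^t N_n(x,y,s)\,ds,$$ where $\widehat{\rho}_0=\frac{1}{\rho_0}$ and $\widehat{\rho}_k=-\frac{1}{\rho_0}\sum_{j=1}^{k}\rho_j\,\widehat{\rho}_{k-j}$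 for $k\ge 1$. Then for every $n\ge 0$ there exists a function $\overline{N}_n$ depending only on $(x,y)$ such that $$N_n(x,y,t)=t^n\,\overline{N}_n(x,y)\qquad\text{for all }(x,y)\in\Omega\text{ and all } t\ge 0$$ (with the convention $t^0=1$).
   Context: The two-dimensional compressible Euler equations in primitive variables $Q=(\rho,u,v,p)^t$ (density, velocity components, pressure; $\gamma$ is the ratio of specific heats) are $$\partial_t\rho+\partial_x(\rho u)+\partial_y(\rho v)=0,\quad \partial_t u+u\,\partial_x u+v\,\partial_y u+\tfrac1\rho\partial_x p=0,$$ $$\partial_t v+u\,\partial_x v+v\,\partial_y v+\tfrac1\rho\partial_y p=0,\quad \partial_t p+u\,\partial_x p+v\,\partial_y p+\gamma p(\partial_x u+\partial_y v)=0.$$ The Adomian decomposition writes the solution formally as $Q=\sum_{n\ge 0}Q_n$, where $Q_0(x,y)=Q(x,y,0)$ is the initial condition and the later terms $Q_{n+1}$ are obtained by integrating the Adomian polynomials $N_n$ in time from $0$ to $t$. The functions $\widehat{\rho}_k$ are the coefficients of the formal power series in $\lambda$ inverse to $\sum_{k}\lambda^k\rho_k$, i.e. $\bigl(\sum_k\lambda^k\rho_k\bigr)\bigl(\sum_k\lambda^k\widehat{\rho}_k\bigr)=1$. The recursion is well founded: $Q_0,\dots,Q_n$ determine $\widehat\rho_0,\dots,\widehat\rho_n$ and $N_n$, which determines $Q_{n+1}$. *)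

(* Defs.v *)
From Stdlib Require Import Reals.
From Coquelicot Require Import Coquelicot.
Open Scope R_scope.

(* C^infinity on an open set: [ex_diff_n f n x y] says that all iterated partial
   derivatives of f of order <= n exist and are jointly continuous at (x, y). *)
Definition smooth_on (Omega : R * R -> Prop) (f : R -> R -> R) : Prop :=
  forall x y, Omega (x, y) -> forall n : nat, ex_diff_n f n x y.

(* A 4-vector indexed by the primitive variables (rho, u, v, p); for N_n the
   components are (A_n, B_n, C_n, D_n), the right-hand sides of the equations
   for rho, u, v and p respectively. *)
Record vec4 (T : Type) := Vec4 { c_rho : T; c_u : T; c_v : T; c_p : T }.
Arguments Vec4 {T}.
Arguments c_rho {T}.
Arguments c_u {T}.
Arguments c_v {T}.
Arguments c_p {T}.

Definition dx (f : R -> R -> R -> R) (x y t : R) : R :=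
  Derive (fun z => f z y t) x.
Definition dy (f : R -> R -> R -> R) (x y t : R) : R :=
  Derive (fun z => f x z t) y.

(* [rhat] stands for the coefficients of the inverse of sum_k lambda^k rho_k.
   [sum_n F n] is F 0 + ... + F n. *)
Definition adomian_N (gamma : R) (Q : nat -> vec4 (R -> R -> R -> R))
    (rhat : nat -> R -> R -> R -> R) (n : nat) : vec4 (R -> R -> R -> R) :=
  let rho k := c_rho (Q k) in
  let u k := c_u (Q k) in
  let v k := c_v (Q k) in
  let p k := c_p (Q k) in
  {| c_rho := fun x y t =>
       - sum_n (fun j =>
           dx (fun x' y' t' => rho (n - j)%nat x' y' t' * u j x' y' t') x y t
           + dy (fun x' y' t' => rho (n - j)%nat x' y' t' * v j x' y' t') x y t) n;
     c_u := fun x y t =>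
       - sum_n (fun j =>
           u (n - j)%nat x y t * dx (u j) x y t
           + v (n - j)%nat x y t * dy (u j) x y t
           + rhat (n - j)%nat x y t * dx (p j) x y t) n;
     c_v := fun x y t =>
       - sum_n (fun j =>
           u (n - j)%nat x y t * dx (v j) x y t
           + v (n - j)%nat x y t * dy (v j) x y t
           + rhat (n - j)%nat x y t * dy (p j) x y t) n;
     c_p := fun x y t =>
       - sum_n (fun j =>
           u (n - j)%nat x y t * dx (p j) x y t
           + v (n - j)%nat x y t * dy (p j) x y t
           + gamma * p j x y t
             * (dx (u (n - j)%nat) x y t + dy (v (n - j)%nat) x y t)) n |}.

(* The sequences Q and rhat are the ones generated from the initial data Q0.
   All equations are imposed only for (x, y) in Omega and t >= 0.  [Derive] and
   [RInt] are total, so no differentiability or integrability of the Q_n and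
   N_n is hidden in this hypothesis. *)
Record adomian_decomposition (Omega : R * R -> Prop) (gamma : R)
    (Q0 : vec4 (R -> R -> R)) (Q : nat -> vec4 (R -> R -> R -> R))
    (rhat : nat -> R -> R -> R -> R) : Prop := {
  adomian_init : forall x y t, Omega (x, y) -> 0 <= t ->
    c_rho (Q 0%nat) x y t = c_rho Q0 x y /\
    c_u (Q 0%nat) x y t = c_u Q0 x y /\
    c_v (Q 0%nat) x y t = c_v Q0 x y /\
    c_p (Q 0%nat) x y t = c_p Q0 x y;
  adomian_rhat_0 : forall x y t, Omega (x, y) -> 0 <= t ->
    rhat 0%nat x y t = 1 / c_rho (Q 0%nat) x y t;
  adomian_rhat_pos : forall (k : nat) x y t, (1 <= k)%nat ->
    Omega (x, y) -> 0 <= t ->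
    rhat k x y t =
      - (1 / c_rho (Q 0%nat) x y t)
      * sum_n_m (fun j => c_rho (Q j) x y t * rhat (k - j)%nat x y t) 1 k;
  adomian_step : forall (n : nat) x y t, Omega (x, y) -> 0 <= t ->
    c_rho (Q (S n)) x y t
      = RInt (fun s => c_rho (adomian_N gamma Q rhat n) x y s) 0 t /\
    c_u (Q (S n)) x y t
      = RInt (fun s => c_u (adomian_N gamma Q rhat n) x y s) 0 t /\
    c_v (Q (S n)) x y t
      = RInt (fun s => c_v (adomian_N gamma Q rhat n) x y s) 0 t /\
    c_p (Q (S n)) x y t
      = RInt (fun s => c_p (adomian_N gamma Q rhat n) x y s) 0 t
}.

(* Main.v *)
(** A function of [(x, y, t)] of the form [t^n g(x, y)] is homogeneous of degree
    [n] in [t].  Degrees add under products, spatial derivatives preserve the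
    degree, and integration from [0] to [t] raises it by one.  Every term of
    [N_n] pairs indices with sum [n], so strong induction shows that [Q_n],
    [rhat_n] and [N_n] all have degree [n].  Taking [t = 1] identifies [g], hence
    the witness is [N_n] at time 1.  Differentiability plays no role: [Derive] is
    total and commutes with scalar multiplication even where the limit of the
    difference quotients does not exist. *)
Require Import Defs.
From Stdlib Require Import Reals Lia Lra Arith.
From Coquelicot Require Import Coquelicot.
Open Scope R_scope.

(** The coefficient is the value at time 1 rather than an existentially bound function, so no
    witness has to be carried through the closure lemmas. *)
Definition homogeneous_t (Omega : R * R -> Prop) (n : nat)
    (f : R -> R -> R -> R) : Prop :=
  forall x y t, Omega (x, y) -> 0 <= t -> f x y t = t ^ n * f x y 1.

Lemma open_locally_fst (Omega : R * R -> Prop) (x y : R) :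
  open Omega -> Omega (x, y) -> locally x (fun z => Omega (z, y)).
Proof.
  intros HO Hxy.
  destruct (HO _ Hxy) as [eps He].
  exists eps; intros z Hz.
  apply He; split; [exact Hz | apply ball_center].
Qed.

Lemma open_locally_snd (Omega : R * R -> Prop) (x y : R) :
  open Omega -> Omega (x, y) -> locally y (fun z => Omega (x, z)).
Proof.
  intros HO Hxy.
  destruct (HO _ Hxy) as [eps He].
  exists eps; intros z Hz.
  apply He; split; [apply ball_center | exact Hz].
Qed.

(** * Closure properties of homogeneity in time *)

Section Homogeneous.

Variable Omega : R * R -> Prop.

Lemma homogeneous_t_ext (n : nat) (f g : R -> R -> R -> R) :
  (forall x y t, Omega (x, y) -> 0 <= t -> g x y t = f x y t) ->
  homogeneous_t Omega n f -> homogeneous_t Omega n g.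
Proof.
  intros E Hf x y t Hxy Ht.
  rewrite !E by (assumption || lra).
  now apply Hf.
Qed.

Lemma homogeneous_t_const (f : R -> R -> R) :
  homogeneous_t Omega 0 (fun x y _ => f x y).
Proof. intros x y t _ _; simpl; ring. Qed.

Lemma homogeneous_t_plus (n : nat) (f g : R -> R -> R -> R) :
  homogeneous_t Omega n f -> homogeneous_t Omega n g ->
  homogeneous_t Omega n (fun x y t => f x y t + g x y t).
Proof.
  intros Hf Hg x y t Hxy Ht.
  rewrite (Hf x y t), (Hg x y t) by assumption; ring.
Qed.

Lemma homogeneous_t_opp (n : nat) (f : R -> R -> R -> R) :
  homogeneous_t Omega n f -> homogeneous_t Omega n (fun x y t => - f x y t).
Proof.
  intros Hf x y t Hxy Ht.
  rewrite (Hf x y t) by assumption; ring.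
Qed.

Lemma homogeneous_t_mult (a b n : nat) (f g : R -> R -> R -> R) :
  (a + b = n)%nat ->
  homogeneous_t Omega a f -> homogeneous_t Omega b g ->
  homogeneous_t Omega n (fun x y t => f x y t * g x y t).
Proof.
  intros <- Hf Hg x y t Hxy Ht.
  rewrite (Hf x y t), (Hg x y t), pow_add by assumption; ring.
Qed.

(** Degree 0 means constant in [t], and then the reciprocal is constant too. *)
Lemma homogeneous_t_inv (f : R -> R -> R -> R) :
  homogeneous_t Omega 0 f -> homogeneous_t Omega 0 (fun x y t => 1 / f x y t).
Proof.
  intros Hf x y t Hxy Ht.
  rewrite (Hf x y t), !pow_O, !Rmult_1_l by assumption; reflexivity.
Qed.

Lemma homogeneous_t_sum (n a b : nat) (F : nat -> R -> R -> R -> R) :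
  (forall j, (a <= j <= b)%nat -> homogeneous_t Omega n (F j)) ->
  homogeneous_t Omega n (fun x y t => sum_n_m (fun j => F j x y t) a b).
Proof.
  intros HF x y t Hxy Ht.
  (* The ring operation [mult], convertible to the product of reals, puts the summand in the form
     that [sum_n_m_mult_l] factors. *)
  rewrite (sum_n_m_ext_loc _ (fun j => mult (t ^ n) (F j x y 1))).
  - exact (sum_n_m_mult_l (t ^ n) (fun j => F j x y 1) a b).
  - intros j Hj; now apply HF.
Qed.

(** At fixed [t] the factor [t ^ n] is a scalar. The derivative sees a whole neighbourhood of [x],
    and openness of [Omega] makes the identity for [f] available on one. *)
Lemma homogeneous_t_dx (n : nat) (f : R -> R -> R -> R) :
  open Omega -> homogeneous_t Omega n f -> homogeneous_t Omega n (dx f).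
Proof.
  intros HO Hf x y t Hxy Ht; unfold dx.
  rewrite <- Derive_scal.
  apply Derive_ext_loc.
  generalize (open_locally_fst Omega x y HO Hxy); apply filter_imp.
  intros z Hz; now apply Hf.
Qed.

Lemma homogeneous_t_dy (n : nat) (f : R -> R -> R -> R) :
  open Omega -> homogeneous_t Omega n f -> homogeneous_t Omega n (dy f).
Proof.
  intros HO Hf x y t Hxy Ht; unfold dy.
  rewrite <- Derive_scal.
  apply Derive_ext_loc.
  generalize (open_locally_snd Omega x y HO Hxy); apply filter_imp.
  intros z Hz; now apply Hf.
Qed.

Lemma RInt_pow_scal (n : nat) (c t : R) :
  RInt (fun s => s ^ n * c) 0 t = t ^ S n * (c / INR (S n)).
Proof.
  assert (Hn : INR (S n) <> 0) by (apply not_0_INR; lia).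
  apply is_RInt_unique.
  (* The antiderivative is [s ^ S n * (c / INR (S n))]; its value at 0 vanishes because the exponent
     is positive. *)
  replace (t ^ S n * (c / INR (S n)))
    with (minus (t ^ S n * (c / INR (S n))) (0 ^ S n * (c / INR (S n))))
    by (rewrite pow_i by lia; unfold minus, plus, opp; simpl; ring).
  apply (is_RInt_derive (fun s => s ^ S n * (c / INR (S n)))).
  - intros s _; auto_derive; [exact I|].
    change (Init.Nat.pred (S n)) with n; field; exact Hn.
  - intros s _.
    apply (ex_derive_continuous (fun s : R => s ^ n * c)).
    auto_derive; exact I.
Qed.

Lemma homogeneous_t_RInt (n : nat) (f : R -> R -> R -> R) :
  homogeneous_t Omega n f ->
  homogeneous_t Omega (S n) (fun x y t => RInt (fun s => f x y s) 0 t).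
Proof.
  intros Hf.
  (* This closed form is used twice, at [t] and at 1, since the required coefficient is the integral
     from 0 to 1. *)
  assert (E : forall x y t, Omega (x, y) -> 0 <= t ->
    RInt (fun s => f x y s) 0 t = t ^ S n * (f x y 1 / INR (S n))).
  { intros x y t Hxy Ht; rewrite <- RInt_pow_scal.
    apply RInt_ext; intros s.
    rewrite Rmin_left by assumption; intros [Hs _].
    apply Hf; [assumption | lra]. }
  intros x y t Hxy Ht.
  rewrite !E, pow1 by (assumption || lra); ring.
Qed.

(** * Degree of the Adomian polynomials *)

Definition vec4_homogeneous_t (n : nat) (q : vec4 (R -> R -> R -> R)) : Prop :=
  homogeneous_t Omega n (c_rho q) /\ homogeneous_t Omega n (c_u q) /\
  homogeneous_t Omega n (c_v q) /\ homogeneous_t Omega n (c_p q).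

Lemma homogeneous_t_adomian_N (gamma : R) (Q : nat -> vec4 (R -> R -> R -> R))
    (rhat : nat -> R -> R -> R -> R) (n : nat) :
  open Omega ->
  (forall k, (k <= n)%nat -> vec4_homogeneous_t k (Q k)) ->
  (forall k, (k <= n)%nat -> homogeneous_t Omega k (rhat k)) ->
  vec4_homogeneous_t n (adomian_N gamma Q rhat n).
Proof.
  intros HO HQ Hr.
  assert (Hrho : forall k, (k <= n)%nat -> homogeneous_t Omega k (c_rho (Q k)))
    by (intros; now apply HQ).
  assert (Hu : forall k, (k <= n)%nat -> homogeneous_t Omega k (c_u (Q k)))
    by (intros; now apply HQ).
  assert (Hv : forall k, (k <= n)%nat -> homogeneous_t Omega k (c_v (Q k)))
    by (intros; now apply HQ).
  assert (Hp : forall k, (k <= n)%nat -> homogeneous_t Omega k (c_p (Q k)))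
    by (intros; now apply HQ).
  pose proof (fun k f => homogeneous_t_dx k f HO) as Hdx.
  pose proof (fun k f => homogeneous_t_dy k f HO) as Hdy.
  unfold vec4_homogeneous_t, adomian_N; cbn [c_rho c_u c_v c_p].
  split; [|split; [|split]]; apply homogeneous_t_opp; unfold sum_n;
    apply homogeneous_t_sum; intros j [_ Hj]; repeat apply homogeneous_t_plus;
    try (apply Hdx || apply Hdy);
    (* All products but one have their factors in the order of degrees [n - j], [j]. *)
    try (apply (homogeneous_t_mult (n - j) j); [lia | |];
         try (apply Hdx || apply Hdy);
         solve [apply Hrho; lia | apply Hu; lia | apply Hv; lia
               | apply Hp; lia | apply Hr; lia]).
  (* What remains is the [gamma] term of the pressure equation: the degrees come in the opposite
     order, and [gamma] itself has degree 0. *)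
  apply (homogeneous_t_mult j (n - j)); [lia | |].
  - apply (homogeneous_t_mult 0 j); [lia | |].
    + apply (homogeneous_t_const (fun _ _ => gamma)).
    + apply Hp; lia.
  - apply homogeneous_t_plus; [apply Hdx, Hu | apply Hdy, Hv]; lia.
Qed.

(** * Propagation of the degree along the recursion *)

Section Decomposition.

Variables (gamma : R) (Q0 : vec4 (R -> R -> R)).
Variables (Q : nat -> vec4 (R -> R -> R -> R)) (rhat : nat -> R -> R -> R -> R).
Hypothesis HO : open Omega.
Hypothesis HQ : adomian_decomposition Omega gamma Q0 Q rhat.

Lemma vec4_homogeneous_t_adomian_init : vec4_homogeneous_t 0 (Q 0%nat).
Proof.
  pose proof (adomian_init _ _ _ _ _ HQ) as E.
  split; [|split; [|split]];
    [ apply (homogeneous_t_ext 0 (fun x y _ => c_rho Q0 x y))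
    | apply (homogeneous_t_ext 0 (fun x y _ => c_u Q0 x y))
    | apply (homogeneous_t_ext 0 (fun x y _ => c_v Q0 x y))
    | apply (homogeneous_t_ext 0 (fun x y _ => c_p Q0 x y)) ];
    try apply homogeneous_t_const;
    intros x y t Hxy Ht; now apply E.
Qed.

Lemma vec4_homogeneous_t_adomian_step (n : nat) :
  vec4_homogeneous_t n (adomian_N gamma Q rhat n) ->
  vec4_homogeneous_t (S n) (Q (S n)).
Proof.
  intros (H1 & H2 & H3 & H4).
  pose proof (adomian_step _ _ _ _ _ HQ n) as E.
  split; [|split; [|split]];
    [ apply (homogeneous_t_ext _ _ _) with (2 := homogeneous_t_RInt _ _ H1)
    | apply (homogeneous_t_ext _ _ _) with (2 := homogeneous_t_RInt _ _ H2)
    | apply (homogeneous_t_ext _ _ _) with (2 := homogeneous_t_RInt _ _ H3)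
    | apply (homogeneous_t_ext _ _ _) with (2 := homogeneous_t_RInt _ _ H4) ];
    intros x y t Hxy Ht; now apply E.
Qed.

(** In the recurrence [1 / rho_0] has degree 0 and each product of [rho_j] and [rhat (k - j)] has
    degree [k]. Only densities up to index [n] are assumed, so the result can be used inside the
    induction on [Q]. *)
Lemma homogeneous_t_rhat (n : nat) :
  (forall k, (k <= n)%nat -> homogeneous_t Omega k (c_rho (Q k))) ->
  homogeneous_t Omega n (rhat n).
Proof.
  induction n as [n IH] using lt_wf_ind; intros Hrho.
  assert (H0 : homogeneous_t Omega 0 (fun x y t => 1 / c_rho (Q 0%nat) x y t))
    by (apply homogeneous_t_inv, Hrho; lia).
  destruct n as [|n].
  - exact (homogeneous_t_ext _ _ _ (adomian_rhat_0 _ _ _ _ _ HQ) H0).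
  - eapply homogeneous_t_ext.
    { intros x y t; apply (adomian_rhat_pos _ _ _ _ _ HQ); lia. }
    apply (homogeneous_t_mult 0 (S n)); [lia | now apply homogeneous_t_opp |].
    apply homogeneous_t_sum; intros j Hj.
    apply (homogeneous_t_mult j (S n - j)); [lia | apply Hrho; lia |].
    (* The sum starts at [j = 1], so [S n - j] is strictly below [S n]. *)
    apply IH; [lia | intros k Hk; apply Hrho; lia].
Qed.

Lemma vec4_homogeneous_t_adomian_N (n : nat) :
  (forall k, (k <= n)%nat -> vec4_homogeneous_t k (Q k)) ->
  vec4_homogeneous_t n (adomian_N gamma Q rhat n).
Proof.
  intros H.
  apply homogeneous_t_adomian_N; [exact HO | exact H |].
  intros k Hk; apply homogeneous_t_rhat.
  intros i Hi; apply H; lia.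
Qed.

Lemma vec4_homogeneous_t_adomian_Q (n : nat) : vec4_homogeneous_t n (Q n).
Proof.
  induction n as [n IH] using lt_wf_ind.
  destruct n as [|n].
  - exact vec4_homogeneous_t_adomian_init.
  (* The polynomial integrated to get [Q (S n)] involves only [Q 0], ..., [Q n], all covered by
     [IH]. *)
  - apply vec4_homogeneous_t_adomian_step, vec4_homogeneous_t_adomian_N.
    intros k Hk; apply IH; lia.
Qed.

End Decomposition.

End Homogeneous.

Theorem mainTheorem1 (Omega : R * R -> Prop) (gamma : R)
    (Q0 : vec4 (R -> R -> R)) (Q : nat -> vec4 (R -> R -> R -> R))
    (rhat : nat -> R -> R -> R -> R)
    (HOmega : open Omega)
    (Hsmooth_rho : smooth_on Omega (c_rho Q0))
    (Hsmooth_u : smooth_on Omega (c_u Q0))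
    (Hsmooth_v : smooth_on Omega (c_v Q0))
    (Hsmooth_p : smooth_on Omega (c_p Q0))
    (Hrho_pos : forall x y, Omega (x, y) -> 0 < c_rho Q0 x y)
    (HQ : adomian_decomposition Omega gamma Q0 Q rhat) :
  forall n : nat, exists Nbar : vec4 (R -> R -> R),
    forall x y t, Omega (x, y) -> 0 <= t ->
      c_rho (adomian_N gamma Q rhat n) x y t = t ^ n * c_rho Nbar x y /\
      c_u (adomian_N gamma Q rhat n) x y t = t ^ n * c_u Nbar x y /\
      c_v (adomian_N gamma Q rhat n) x y t = t ^ n * c_v Nbar x y /\
      c_p (adomian_N gamma Q rhat n) x y t = t ^ n * c_p Nbar x y.
Proof.
  intros n.
  set (N := adomian_N gamma Q rhat n).
  exists {| c_rho := fun x y => c_rho N x y 1; c_u := fun x y => c_u N x y 1;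
            c_v := fun x y => c_v N x y 1; c_p := fun x y => c_p N x y 1 |}.
  intros x y t Hxy Ht.
  destruct (vec4_homogeneous_t_adomian_N Omega gamma Q0 Q rhat HOmega HQ n)
    as (H1 & H2 & H3 & H4).
  { intros k _; now apply (vec4_homogeneous_t_adomian_Q Omega gamma Q0 Q rhat). }
  repeat split; [now apply H1 | now apply H2 | now apply H3 | now apply H4].
Qed.
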